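(* For the single-segment ($m=1$) total-energy platooning problem with an arbitrary number $n$ of vehicles and arbitrary vehicle parameters (minimize $\sum_{j=1}^n D_1\delta_j(1-\eta_{[j]})$ over permutations $([1],\ldots,[n])$ of $(1,\ldots,n)$ subject to $S_{j1}-\frac{\delta_j}{C_j}D_1(1-\eta_{[j]})\ge\beta_j$ for $j=1,\ldots,n$), Algorithm Delta runs in $O(n^2)$ time and either proves that the problem is infeasible or, when the problem is feasible, finds an optimal solution.
   Context: Setting. There are $n$ vehicles $1,\ldots,n$ and one road segment of length $D_1>0$. Vehicle $j$ has battery capacity $C_j>0$, energy usage rate $\delta_j>0$, initial state of charge $S_{j1}\in[0,1]$, and minimum allowable state of charge $\beta_j$ with $0\le\beta_j<S_{j1}$. Platoon positions $1,\ldots,n$ have usage-rate reductions $0\le\eta_1\le\cdots\le\eta_n<1$. A solution is a permutation $([1],\ldots,[n])$, where $[j]$ is the position of vehicle $j$; vehicle $j$ then uses energy $D_1\delta_j(1-\eta_{[j]})$ and its final state of charge is $S_{j1}-D_1\delta_j(1-\eta_{[j]})/C_j$. A solution is feasible if every final state of charge is at least $\beta_j$; the problem is infeasible if no feasible solution exists. Write $\lambda_k=1-\eta_k$. Algorithm Delta. Step 0: Reindex the vehicles in non-decreasing order of $\delta_j$ (ties by increasing initial index). For $k=1,\ldots,n$ let $E_k=\{j : S_{j1}-\frac{\delta_j}{C_j}D_1\lambda_k\ge\beta_j\}$. Set $q=1$ and $V=\emptyset$. Step 1: If $E_q$ is empty, declare the problem infeasible. Otherwise assign the vehicle $u\in E_q$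 with smallest index to position $q$. Step 2: If $q=n$, stop. Otherwise set $V=V\cup\{u\}$, $E_{q+1}=E_{q+1}\setminus V$, $q=q+1$, and go to Step 1. Running time counts elementary arithmetic operations and comparisons. *)

(* Defs.v *)
From HB Require Import structures.
From mathcomp Require Import all_boot all_order all_algebra all_fingroup.

Set Implicit Arguments.
Unset Strict Implicit.
Unset Printing Implicit Defensive.

Import Order.TTheory GRing.Theory Num.Theory.
Local Open Scope ring_scope.

(* Vehicles and platoon positions 1, ..., n are both represented by 'I_n
   (numbered from 0), in the same order. *)
Record platoon (R : realFieldType) (n : nat) := Platoon {
  dist : R;                         (* D_1 *)
  capacity : 'I_n -> R;             (* C_j *)
  rate : 'I_n -> R;                 (* delta_j *)
  soc : 'I_n -> R;                  (* S_{j1} *)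
  min_soc : 'I_n -> R;              (* beta_j *)
  reduction : 'I_n -> R;            (* eta_k *)
  dist_gt0 : 0 < dist;
  capacity_gt0 : forall j, 0 < capacity j;
  rate_gt0 : forall j, 0 < rate j;
  soc_bounds : forall j, 0 <= soc j <= 1;
  min_soc_bounds : forall j, 0 <= min_soc j < soc j;
  reduction_bounds : forall k, 0 <= reduction k < 1;
  reduction_mono : forall k l : 'I_n, (k <= l)%N -> reduction k <= reduction l
}.

Section Problem.
Variables (R : realFieldType) (n : nat) (P : platoon R n).

(* A solution is a permutation s, with s j the position of vehicle j. *)
Implicit Types s t : 'S_n.

Definition energy s (j : 'I_n) : R :=
  dist P * rate P j * (1 - reduction P (s j)).

Definition total_energy s : R := \sum_(j < n) energy s j.

Definition final_soc s (j : 'I_n) : R :=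
  soc P j - energy s j / capacity P j.

Definition feasible s : Prop := forall j, min_soc P j <= final_soc s j.

Definition infeasible_problem : Prop := ~ exists s, feasible s.

Definition optimal s : Prop :=
  feasible s /\ forall t, feasible t -> total_energy s <= total_energy t.

Definition vehicles_by_position s : seq 'I_n :=
  [seq (s^-1)%g q | q <- enum 'I_n].

End Problem.

(* A computation is a result paired with the number of elementary steps
   performed.  An arithmetic operation or comparison on scalars, a comparison
   of vehicle indices, and a Boolean operation each cost 1; every list cell
   visited costs 1 more, so that iteration is not free either.  Looking up a
   given parameter (rate P j, etc.) is free. *)
Definition comp (A : Type) : Type := (A * nat)%type.
Definition result A (m : comp A) : A := m.1.
Definition runtime A (m : comp A) : nat := m.2.

Definition ret A (a : A) : comp A := (a, 0%N).
Definition step A (a : A) : comp A := (a, 1%N).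
Definition bind A B (m : comp A) (f : A -> comp B) : comp B :=
  (result (f (result m)), (runtime m + runtime (f (result m)))%N).

Notation "'let*' x ':=' m 'in' k" := (bind m (fun x => k))
  (at level 200, x name, m at level 100, k at level 200, right associativity).

Definition tick A (m : comp A) : comp A := let* _ := step tt in m.

Section Primitives.
Variable R : realFieldType.
Definition subC (x y : R) : comp R := step (x - y).
Definition mulC (x y : R) : comp R := step (x * y).
Definition divC (x y : R) : comp R := step (x / y).
Definition leC (x y : R) : comp bool := step (x <= y).
Definition eqC (n : nat) (i j : 'I_n) : comp bool := step (i == j).
Definition orC (a b : bool) : comp bool := step (a || b).
Definition andnC (a b : bool) : comp bool := step (a && ~~ b).
End Primitives.

Fixpoint mapC A B (f : A -> comp B) (s : seq A) : comp (seq B) :=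
  if s is x :: s' then
    tick (let* y := f x in let* t := mapC f s' in ret (y :: t))
  else ret [::].

Fixpoint map2C A B C (f : A -> B -> comp C) (s : seq A) (t : seq B) :
    comp (seq C) :=
  match s, t with
  | x :: s', y :: t' =>
      tick (let* z := f x y in let* r := map2C f s' t' in ret (z :: r))
  | _, _ => ret [::]
  end.

Section AlgorithmDelta.
Variables (R : realFieldType) (n : nat) (P : platoon R n).

Fixpoint insertC (i : 'I_n) (s : seq 'I_n) : comp (seq 'I_n) :=
  if s is j :: s' then
    tick (let* b := leC (rate P i) (rate P j) in
          if b then ret (i :: s)
          else let* t := insertC i s' in ret (j :: t))
  else ret [:: i].

(* Insertion into the already sorted tail is stable: on equal rates the vehicle
   that comes first in the input stays first. *)
Fixpoint sortC (s : seq 'I_n) : comp (seq 'I_n) :=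
  if s is i :: s' then tick (let* t := sortC s' in insertC i t)
  else ret [::].

Definition eligibleC (k j : 'I_n) : comp bool :=
  let* lambda := subC 1 (reduction P k) in
  let* a := divC (rate P j) (capacity P j) in
  let* b := mulC a (dist P) in
  let* e := mulC b lambda in
  let* f := subC (soc P j) e in
  leC (min_soc P j) f.

(* Below, vs lists the vehicles in their new order, and a set of vehicles is
   the sequence of its membership bits along vs. *)

Fixpoint smallestC (E : bitseq) (vs : seq 'I_n) : comp (option 'I_n) :=
  match E, vs with
  | b :: E', j :: vs' => tick (if b then ret (Some j) else smallestC E' vs')
  | _, _ => ret None
  end.

Definition addC (vs : seq 'I_n) (u : 'I_n) (V : bitseq) : comp bitseq :=
  map2C (fun v j => let* b := eqC j u in orC v b) V vs.

Definition diffC (E V : bitseq) : comp bitseq := map2C andnC E V.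

(* E is the current E_q and Es lists E_(q+1), ..., E_n as computed initially.
   The answer lists the vehicles assigned to positions q, ..., n, or is None
   when the problem is declared infeasible. *)
Fixpoint assignC (vs : seq 'I_n) (E : bitseq) (Es : seq bitseq) (V : bitseq) :
    comp (option (seq 'I_n)) :=
  tick (let* o := smallestC E vs in
        if o is Some u then
          if Es is E' :: Es' then
            let* V' := addC vs u V in
            let* E'' := diffC E' V' in
            let* r := assignC vs E'' Es' V' in
            ret (omap (cons u) r)
          else ret (Some [:: u])
        else ret None).

Definition algorithm_delta : comp (option (seq 'I_n)) :=
  let* vs := sortC (enum 'I_n) in
  let* Es := mapC (fun k => mapC (eligibleC k) vs) (enum 'I_n) in
  let* V := mapC (fun=> ret false) vs in
  if Es is E :: Es' then assignC vs E Es' V else ret (Some [::]).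

End AlgorithmDelta.

(* Main.v *)
Require Import Defs.
From mathcomp Require Import all_boot all_order all_algebra all_fingroup.
From mathcomp Require Import zify ring.

(* Since the reductions increase along the platoon, a vehicle eligible for a
   position is eligible for every later one.  Let u be the vehicle that the
   algorithm puts in the first open position k, and let v be the vehicle that a
   competing solution puts there.  Exchanging u and v in that solution keeps it
   feasible, as v is eligible for k and hence for the later position of u; and it
   does not increase the energy, as u has the smaller usage rate and k the
   smaller reduction.  Induction on the open positions concludes.  For the
   running time, each position costs O(n) list steps. *)

Set Implicit Arguments.
Unset Strict Implicit.
Unset Printing Implicit Defensive.

Import Order.TTheory GRing.Theory Num.Theory.

(** * Results and costs of the list primitives *)

Section Computations.
Local Open Scope nat_scope.

Lemma result_mapC A B (f : A -> Defs.comp B) s :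
  result (mapC f s) = [seq result (f x) | x <- s].
Proof. by elim: s => //= x s <-. Qed.

Lemma runtime_mapC A B (f : A -> Defs.comp B) s c :
  (forall x, runtime (f x) <= c) -> runtime (mapC f s) <= c.+1 * size s.
Proof.
move=> fc; elim: s => //= x s IHs.
rewrite /tick /bind /runtime /= in IHs *; have := fc x; rewrite /runtime.
nia.
Qed.

(** Both arguments are images of one list because every vehicle set is a list of bits along [vs]. *)
Lemma result_map2C A B C D (f : A -> B -> Defs.comp C) (g : D -> A) (h : D -> B) s :
  result (map2C f (map g s) (map h s)) = [seq result (f (g x) (h x)) | x <- s].
Proof. by elim: s => //= x s <-. Qed.

Lemma runtime_map2C A B C (f : A -> B -> Defs.comp C) s t c :
  (forall x y, runtime (f x y) <= c) -> runtime (map2C f s t) <= c.+1 * size t.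
Proof.
move=> fc; elim: s t => [|x s IHs] [|y t] //=.
have := IHs t; rewrite /tick /bind /runtime /=; have := fc x y; rewrite /runtime.
nia.
Qed.

Lemma runtime_smallestC n (E : bitseq) (vs : seq 'I_n) :
  runtime (smallestC E vs) <= size vs.
Proof.
elim: E vs => [|b E IHE] [|v vs] //=; have := IHE vs.
by rewrite /tick /bind /runtime /=; case: b => /=; lia.
Qed.

(** Each position costs one tick, at most [size vs] for the search, 3 per cell for [addC] (cell,
    comparison, disjunction) and 2 per cell for [diffC]. *)
Lemma runtime_assignC n (vs : seq 'I_n) E Es V :
  runtime (assignC vs E Es V) <= (6 * size vs).+1 * (size Es).+1.
Proof.
elim: Es E V => [|E' Es IHEs] E V /=; have := runtime_smallestC E vs;
  rewrite /tick /bind /runtime /=; case: (result _) => [u|] /=; try lia.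
set V' := result (Defs.addC _ _ _); set E'' := result (diffC _ _).
have := IHEs E'' V'; rewrite /runtime.
have : runtime (Defs.addC vs u V) <= 3 * size vs by exact: runtime_map2C.
(* The cost of [diffC] is measured by its second argument [V'], whose length is thus controlled by
   [vs]. *)
have size_add (W : bitseq) : size (result (Defs.addC vs u W)) <= size vs.
  rewrite /Defs.addC; elim: (vs) W => [|w ws IHws] [|b W] //=.
  exact: IHws W.
have : runtime (diffC E' V') <= 2 * size V' by exact: runtime_map2C.
have := size_add V; rewrite -/V' /runtime.
nia.
Qed.

End Computations.

Section Greedy.
Local Open Scope ring_scope.
Variables (R : realFieldType) (n : nat) (P : platoon R n).

(** * Eligibility and energy of a vehicle at a position *)

Definition usage (k j : 'I_n) : R := dist P * rate P j * (1 - reduction P k).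

(** Grouped as in [final_soc] rather than as in [eligibleC], so that feasibility of [s] unfolds to
    eligibility of each [j] at [s j]. *)
Definition eligible (k j : 'I_n) : bool :=
  min_soc P j <= soc P j - usage k j / capacity P j.

Lemma result_eligibleC k j : result (eligibleC P k j) = eligible k j.
Proof.
rewrite /eligible /usage /result /=; congr (_ <= _ - _).
by ring.
Qed.

Lemma eligible_mono (k l j : 'I_n) : (k <= l)%N -> eligible k j -> eligible l j.
Proof.
move=> kl /le_trans; apply; rewrite lerD2l lerN2.
rewrite ler_pM2r ?invr_gt0 ?capacity_gt0 // ler_pM2l ?lerD2l ?lerN2.
  exact: reduction_mono.
by rewrite mulr_gt0 ?dist_gt0 ?rate_gt0.
Qed.

(** Rearrangement inequality: the two sides differ by the distance times the gap in rates times the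
    gap in reductions. *)
Lemma usage_exchange (k l u v : 'I_n) : (k <= l)%N -> rate P u <= rate P v ->
  usage k u + usage l v <= usage k v + usage l u.
Proof.
move=> /(reduction_mono P) kl uv.
rewrite -subr_ge0 [leRHS](_ : _ = dist P * ((rate P v - rate P u) *
  (reduction P l - reduction P k))); last by rewrite /usage; ring.
by rewrite !mulr_ge0 ?subr_ge0 // ltW ?dist_gt0.
Qed.

Lemma usage_mono (k u v : 'I_n) : rate P u <= rate P v -> usage k u <= usage k v.
Proof.
move=> uv; rewrite ler_wpM2r ?ler_wpM2l ?(ltW (dist_gt0 _)) //.
by have /andP[_ /ltW] := reduction_bounds P k; rewrite subr_ge0.
Qed.

(** * Sorting by usage rate and the choice of a vehicle *)

Definition by_rate : rel 'I_n := fun i j => rate P i <= rate P j.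

Lemma result_insertC i s : result (insertC P i s) =
  if s is j :: s' then
    if rate P i <= rate P j then i :: s else j :: result (insertC P i s')
  else [:: i].
Proof. by case: s => //= j s; rewrite /result /=; case: ifP. Qed.

Lemma perm_insertC i s : perm_eq (result (insertC P i s)) (i :: s).
Proof.
elim: s => [|j s IHs]; rewrite result_insertC //; case: ifP => // _.
rewrite -(perm_cons j) in IHs; apply: perm_trans IHs _.
by apply/seq.permP => p /=; rewrite addnCA.
Qed.

Lemma sorted_insertC i s :
  sorted by_rate s -> sorted by_rate (result (insertC P i s)).
Proof.
elim: s => [|j s IHs]; rewrite result_insertC // => sj.
case: leP => ij; first by rewrite /= /by_rate ij.
have by_rate_tr : transitive by_rate by move=> y x z; apply: le_trans.
(* Once the path is split into a bound by [j] and sortedness, the bound can be checked on the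
   permuted list [i :: s]. *)
move: sj; rewrite /= !(path_sortedE by_rate_tr) => /andP[js /IHs ->].
by rewrite (perm_all _ (perm_insertC i s)) /= js /by_rate ltW.
Qed.

Lemma perm_sortC s : perm_eq (result (sortC P s)) s.
Proof.
elim: s => //= i s IHs; rewrite /result /=.
by apply: perm_trans (perm_insertC _ _) _; rewrite perm_cons.
Qed.

Lemma sorted_sortC s : sorted by_rate (result (sortC P s)).
Proof. by elim: s => //= i s IHs; rewrite /result /=; apply: sorted_insertC. Qed.

Lemma runtime_insertC i s : (runtime (insertC P i s) <= 2 * size s)%N.
Proof.
elim: s => //= j s; rewrite /tick /bind /runtime /=.
by case: (rate P i <= rate P j) => /=; lia.
Qed.

Lemma runtime_sortC s : (runtime (sortC P s) <= 2 * size s ^ 2)%N.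
Proof.
elim: s => //= i s IHs; rewrite /tick /bind /runtime /= in IHs *.
have := runtime_insertC i (result (sortC P s)).
rewrite (perm_size (perm_sortC s)) /runtime; move: IHs.
by move: (sortC P s).2 (insertC P i _).2 (size s) => a b c; nia.
Qed.

(** In a list sorted by rate, the first member of a set has the least rate in it. *)
Lemma smallestC_spec (p : pred 'I_n) vs : sorted by_rate vs ->
  if result (smallestC (map p vs) vs) is Some u then
    p u /\ {in vs, forall v, p v -> rate P u <= rate P v}
  else {in vs, forall v, ~~ p v}.
Proof.
elim: vs => //= v vs IHvs vvs; rewrite /result /=.
have [pv|npv] /= := boolP (p v).
  split=> // w; rewrite inE => /predU1P[-> //|wvs] _.
  have /allP := order_path_min (fun y x z => @le_trans _ R _ _ _) vvs.
  exact.
have := IHvs (path_sorted vvs); rewrite /result.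
case: (smallestC _ _).1 => [u [pu umin]|nop].
  split=> // w; rewrite inE => /predU1P[->|/umin //].
  by rewrite (negPf npv).
by move=> w; rewrite inE => /predU1P[->|/nop].
Qed.

(** * The exchange argument on lists of vehicles *)

(* ws lists vehicles for the open positions ks, the vehicles in A being already
   assigned to earlier positions. *)
Definition admissible (A ks ws : seq 'I_n) : bool :=
  [&& uniq ws, all [predC A] ws & all2 eligible ks ws].

(** [zip] truncates, but [all2] in [admissible] forces equal lengths. *)
Definition cost (ks ws : seq 'I_n) : R :=
  \sum_(p <- zip ks ws) usage p.1 p.2.

Lemma cost_cons k ks w ws : cost (k :: ks) (w :: ws) = usage k w + cost ks ws.
Proof. by rewrite /cost /= big_cons. Qed.

Lemma map_tperm_id (u v : 'I_n) ws : u \notin ws -> v \notin ws ->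
  map (tperm u v) ws = ws.
Proof.
move=> nu nv; apply: map_id_in => w ww; apply: tpermD.
  by apply: contraNneq nu => ->.
by apply: contraNneq nv => ->.
Qed.

(** Applying [tperm u v] to the tail covers both cases: if [u] occurs at some [l], only that entry
    changes and [usage_exchange] applies; if [u] is not met, [u] merely replaces [v] at [k], by
    [usage_mono]. *)
Lemma cost_exchange (k u v : 'I_n) ks ws :
    all (fun l : 'I_n => k <= l)%N ks -> rate P u <= rate P v ->
    uniq (v :: ws) ->
  usage k u + cost ks (map (tperm u v) ws) <= usage k v + cost ks ws.
Proof.
move=> + uv; elim: ks ws => [|l ks IHks] [|w ws] /=;
  rewrite ?[cost [::] _]big_nil ?[cost _ [::]]big_nil ?lerD2r ?usage_mono //.
move=> /andP[kl kks]; rewrite inE negb_or -andbA => /and4P[vw nv nw uws].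
rewrite !cost_cons; have [{vw}wu|uw] := eqVneq w u.
  rewrite wu in nw *; rewrite tpermL map_tperm_id //.
  by rewrite !addrA lerD2r usage_exchange.
rewrite tpermD 1?eq_sym //; last by rewrite eq_sym.
by rewrite !(addrCA _ (usage l w)) lerD2l IHks //= nv.
Qed.

(** The only entry that can change is [u], replaced by [v], which is eligible at [k] and so at every
    later position. *)
Lemma all2_eligible_exchange (k u v : 'I_n) ks ws :
    all (fun l : 'I_n => k <= l)%N ks -> eligible k v -> v \notin ws ->
  all2 eligible ks ws -> all2 eligible ks (map (tperm u v) ws).
Proof.
move=> + kv; elim: ks ws => [|l ks IHks] [|w ws] //= /andP[kl kks].
rewrite inE negb_or => /andP[vw vws] /andP[lw lws].
rewrite IHks // andbT; case: tpermP lw => // [_ _|wv].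
  exact: eligible_mono kv.
by rewrite wv eqxx in vw.
Qed.

Lemma admissible_exchange A (k u v : 'I_n) ks ws :
    all (fun l : 'I_n => k <= l)%N ks -> admissible A (k :: ks) (v :: ws) ->
  admissible (u :: A) ks (map (tperm u v) ws).
Proof.
move=> kks /and3P[/= /andP[nv uws] /andP[vA wsA] /andP[kv kws]].
apply/and3P; split; first by rewrite (map_inj_uniq perm_inj).
  apply/allP => _ /mapP[w ww ->]; rewrite !inE negb_or.
  (* Only [v] is sent to [u], and [v] is not in the tail, so the new tail avoids [u]. *)
  have wv : w != v by apply: contraNneq nv => <-.
  case: tpermP wv => [->|->|/eqP -> _ _]; rewrite ?eqxx //.
    by move=> uv; rewrite eq_sym uv.
  exact: (allP wsA).
exact: all2_eligible_exchange kv _ _.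
Qed.

(** * Correctness of the assignment loop *)

Lemma assignC_cons (vs : seq 'I_n) E E' Es V : result (assignC vs E (E' :: Es) V) =
  if result (smallestC E vs) is Some u then
    let V' := result (Defs.addC vs u V) in
    omap (cons u) (result (assignC vs (result (diffC E' V')) Es V'))
  else None.
Proof. by rewrite [LHS]/result /=; case: (result (smallestC E vs)). Qed.

Lemma assignC_nil (vs : seq 'I_n) E V : result (assignC vs E [::] V) =
  if result (smallestC E vs) is Some u then Some [:: u] else None.
Proof. by rewrite [LHS]/result /=; case: (result (smallestC E vs)). Qed.

(** The arguments of [assignC] state the loop invariant: the vehicles in [A] are removed from the
    current set only, later sets are still the initial ones, and [V] encodes [A]. *)
Lemma assignC_spec vs A (k : 'I_n) ks :
    sorted by_rate vs -> vs =i 'I_n ->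
    sorted (fun l m : 'I_n => l <= m)%N (k :: ks) ->
  if result (assignC vs [seq eligible k v && (v \notin A) | v <- vs]
       [seq [seq eligible l v | v <- vs] | l <- ks] [seq v \in A | v <- vs])
  is Some ws then
    admissible A (k :: ks) ws /\
    forall ws', admissible A (k :: ks) ws' ->
      cost (k :: ks) ws <= cost (k :: ks) ws'
  else forall ws', ~~ admissible A (k :: ks) ws'.
Proof.
move=> vs_sorted vsT.
elim: ks k A => [|l ks IHks] k A k_sorted;
    rewrite ?assignC_nil ?assignC_cons;
    have := smallestC_spec (fun v => eligible k v && (v \notin A)) vs_sorted;
    case: (result (smallestC _ _)) => [u [/andP[ku uA] umin]|no_v].
- split; first by rewrite /admissible /= uA ku.
  move=> [|v [|w ws]] /and3P[_ vA kv] //; last by rewrite /= andbF in kv.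
  rewrite !cost_cons lerD2r usage_mono // umin ?vsT //.
  by move: vA kv; rewrite /= !andbT => -> ->.
- case=> [|v ws]; rewrite /admissible ?andbF //=; apply/negP.
  case/and3P=> _ /andP[vA _] /andP[kv _].
  by have := no_v v; rewrite vsT kv vA => /(_ isT).
- have kks : all (fun m : 'I_n => k <= m)%N (l :: ks).
    by apply: order_path_min k_sorted => x y z; apply: leq_trans.
  have -> : result (Defs.addC vs u [seq v \in A | v <- vs])
      = [seq v \in u :: A | v <- vs].
    (* Writing [vs] as its image under the identity gives the form that [result_map2C] expects. *)
    rewrite /Defs.addC -[X in map2C _ _ X]map_id result_map2C.
    by apply: eq_map => v; rewrite inE orbC.
  rewrite /= /diffC result_map2C.
  have := IHks l (u :: A) (path_sorted k_sorted).
  case: (result _) => [ws [ws_adm ws_min]|no_ws] /=.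
    split.
      case/and3P: ws_adm => uws wsA lws; apply/and3P; split.
      - by rewrite /= uws andbT; apply/negP => /(allP wsA); rewrite !inE eqxx.
      - rewrite /= uA; apply: sub_all wsA => w.
        by rewrite !inE negb_or => /andP[].
      - exact/andP.
    move=> [|v ws'] adm; first by case/and3P: adm.
    have uv : rate P u <= rate P v.
      case/and3P: (adm) => _ /= /andP[vA _] /andP[kv _].
      by apply: umin; [rewrite vsT | rewrite kv].
    have v_uniq : uniq (v :: ws') by case/and3P: adm.
    rewrite !cost_cons.
    (* The exchanged tail is admissible for the remaining positions, so the induction hypothesis
       bounds the cost of [ws] by its cost. *)
    apply: le_trans (cost_exchange kks uv v_uniq).
    by rewrite lerD2l ws_min // (admissible_exchange u kks adm).
  (* A failure later on is a true infeasibility: the exchange would turn any solution here into one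
     for the remaining positions. *)
  case=> [|v ws']; first by rewrite /admissible andbF.
  by apply: contra (no_ws (map (tperm u v) ws')); apply: admissible_exchange.
- case=> [|v ws]; rewrite /admissible ?andbF //=; apply/negP.
  case/and3P=> _ /andP[vA _] /andP[kv _].
  by have := no_v v; rewrite vsT kv vA => /(_ isT).
Qed.

(** * Permutations as lists of vehicles by position *)

Lemma total_energyE (s : 'S_n) :
  total_energy P s = cost (enum 'I_n) (vehicles_by_position s).
Proof.
rewrite /cost /vehicles_by_position -[X in zip X]map_id zip_map big_map big_enum.
rewrite (reindex_inj (@perm_inj _ s)) /=.
by apply: eq_bigr => j _; rewrite permK.
Qed.

Lemma all2_map_diag (T U : Type) (r : T -> U -> bool) (f : T -> U) (t : seq T) :
  all2 r t (map f t) = all (fun x => r x (f x)) t.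
Proof. by elim: t => //= x t ->. Qed.

Lemma admissible_perm (s : 'S_n) :
  reflect (feasible P s)
          (admissible [::] (enum 'I_n) (vehicles_by_position s)).
Proof.
rewrite /admissible (map_inj_uniq perm_inj) enum_uniq all_predT all2_map_diag.
apply: (iffP allP) => [elig j|feas k _]; last first.
  by have := feas ((s^-1)%g k); rewrite /final_soc /energy permKV.
by have := elig (s j); rewrite mem_enum permK => /(_ isT).
Qed.

Lemma vehicles_by_position_onto ws : uniq ws -> size ws = n ->
  exists s : 'S_n, ws = vehicles_by_position s.
Proof.
(* The default is [k] itself since ['I_n] may be empty; it is never reached, as [ws] has size [n].
   The map [f] sends positions to vehicles, so the solution is its inverse. *)
move=> uws sz_ws; pose f (k : 'I_n) := nth k ws k.
have f_inj : injective f.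
  move=> k l; rewrite /f (set_nth_default l k) ?sz_ws // => /eqP.
  by rewrite nth_uniq ?sz_ws // => /eqP/val_inj.
exists (perm f_inj)^-1%g; rewrite /vehicles_by_position invgK.
case: n ws uws sz_ws @f f_inj => [|m] ws _ sz_ws f f_inj.
  by rewrite (size0nil sz_ws) (size0nil (size_enum_ord 0)).
apply: (@eq_from_nth _ ord0); first by rewrite size_map size_enum_ord.
move=> i; rewrite sz_ws => im.
rewrite (nth_map ord0) ?size_enum_ord // permE /f.
by rewrite nth_enum_ord // (set_nth_default ord0) ?sz_ws.
Qed.

Lemma admissible_enum ws : admissible [::] (enum 'I_n) ws ->
  exists2 s : 'S_n, ws = vehicles_by_position s & feasible P s.
Proof.
move=> adm; case/and3P: (adm) => uws _; rewrite all2E => /andP[/eqP sz _].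
have [|s ws_s] := vehicles_by_position_onto uws; first by rewrite -sz size_enum_ord.
by exists s => //; apply/admissible_perm; rewrite -ws_s.
Qed.

(** * Correctness and running time of the whole algorithm *)

Lemma result_algorithm_delta : (0 < n)%N ->
  (result (algorithm_delta P) = None /\ infeasible_problem P)
  \/ (exists s : 'S_n,
        result (algorithm_delta P) = Some (vehicles_by_position s)
        /\ optimal P s).
Proof.
move=> n_gt0; set vs := result (sortC P (enum 'I_n)).
have vsT : vs =i 'I_n.
  by move=> j; rewrite (perm_mem (perm_sortC _)) mem_enum.
have enum_sorted : sorted (fun l m : 'I_n => l <= m)%N (enum 'I_n).
  by have := iota_sorted 0 n; rewrite -val_enum_ord sorted_map.
have enum_n0 : enum 'I_n <> [::].
  by move=> /(congr1 size); rewrite size_enum_ord => n0; rewrite n0 in n_gt0.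
(* The initial call satisfies the loop invariant with no vehicle assigned. *)
have deltaE : result (algorithm_delta P) =
  if enum 'I_n is k :: ks then
    result (assignC vs [seq eligible k v && (v \notin [::]) | v <- vs]
      [seq [seq eligible l v | v <- vs] | l <- ks] [seq v \in [::] | v <- vs])
  else Some [::].
  have eligE k : result (mapC (eligibleC P k) vs) = [seq eligible k v | v <- vs].
    by rewrite result_mapC; apply: eq_map => v; rewrite result_eligibleC.
  rewrite /algorithm_delta {1}/result /= -/(result _) -/vs !result_mapC /=.
  rewrite (eq_map eligE); case: (enum 'I_n) => //= k ks.
  by congr (result (assignC _ _ _ _)); apply: eq_map => v; rewrite /= andbT.
rewrite deltaE.
case enumE: (enum 'I_n) enum_n0 enum_sorted => [//|k ks] _ k_sorted.
have := assignC_spec [::] (sorted_sortC (enum 'I_n)) vsT k_sorted.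
rewrite -/vs -enumE; case: (result _) => [ws [ws_adm ws_min]|no_ws].
  right; have [s ws_s s_feas] := admissible_enum ws_adm.
  exists s; split; first by rewrite ws_s.
  split=> // t /admissible_perm t_adm.
  by rewrite !total_energyE -ws_s ws_min.
by left; split=> // -[s /admissible_perm]; apply/negP.
Qed.

(** Sorting, eligibility (6 operations and a cell per vehicle, a cell per row), initialization and
    assignment cost at most [2n^2 + (7n+1)n + n + (6n+1)n = 15n^2 + 3n], which is below [19n^2] for
    positive [n]. *)
Lemma runtime_algorithm_delta :
  (0 < n)%N -> (runtime (algorithm_delta P) <= 19 * n ^ 2)%N.
Proof.
move=> n_gt0; rewrite /algorithm_delta.
set vs := result (sortC P (enum 'I_n)).
have sz_vs : size vs = n by rewrite (perm_size (perm_sortC _)) size_enum_ord.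
have sort_time := runtime_sortC (enum 'I_n).
have elig_time : (runtime (mapC (fun k => mapC (eligibleC P k) vs) (enum 'I_n))
    <= (7 * n).+1 * n)%N.
  rewrite -[X in (_ <= _ * X)%N](size_enum_ord n); apply: runtime_mapC => k.
  by rewrite -[X in (_ <= _ * X)%N]sz_vs; apply: runtime_mapC.
have V_time : (runtime (mapC (fun=> ret false) vs) <= 1 * n)%N.
  by rewrite -[X in (_ <= _ * X)%N]sz_vs; apply: runtime_mapC.
rewrite size_enum_ord in sort_time.
rewrite {1}/bind {1}/runtime /= -/vs.
have szE : size (result (mapC (fun k => mapC (eligibleC P k) vs) (enum 'I_n))) = n.
  by rewrite result_mapC size_map size_enum_ord.
case: (mapC _ (enum 'I_n)) szE elig_time => Es t_E /=.
rewrite /result /runtime /=; case: Es => [|E Es] /= szE; first by rewrite -szE in n_gt0.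
have := runtime_assignC vs E Es (result (mapC (fun=> ret false) vs)).
move: sort_time V_time; rewrite sz_vs szE /runtime /result; nia.
Qed.

End Greedy.

Theorem proposition1 :
  exists c : nat,
  forall (R : realFieldType) (n : nat) (P : platoon R n), (0 < n)%N ->
    (runtime (algorithm_delta P) <= c * n ^ 2)%N
    /\ ((result (algorithm_delta P) = None /\ infeasible_problem P)
        \/ (exists s : 'S_n,
              result (algorithm_delta P) = Some (vehicles_by_position s)
              /\ optimal P s)).
Proof.
exists 19 => R n P n_gt0; split; first exact: runtime_algorithm_delta.
exact: result_algorithm_delta.
Qed.
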